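(* Let $K$ be a field of characteristic zero and let $L$ be an infinite filiform Lie algebra over $K$. If $L$ is solvable, then $[L,L]$ is abelian.
   Context: An infinite filiform Lie algebra over a field $K$ is a Lie algebra $L$ over $K$ with a basis $a,e_1,e_2,e_3,\ldots$ satisfying, for all $j\ge 1$, $$[a,e_j]=e_{j+1}\quad\text{and}\quad [e_j,e_{j+1}]=\sum_{s=1}^{\infty}\lambda_{js}\,e_{2j+1+s}$$ for some constants $\lambda_{js}\in K$ ($j,s\ge 1$) such that for each $j$ one has $\lambda_{js}=0$ for all sufficiently large $s$. (The remaining brackets $[e_k,e_m]$ are determined by these and the Jacobi identity.) *)

(* Defs.v *)
From HB Require Import structures.
From mathcomp Require Import all_boot all_algebra.
From mathcomp Require Import classical_sets.

Set Implicit Arguments.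
Unset Strict Implicit.
Unset Printing Implicit Defensive.

Import GRing.Theory.
Local Open Scope classical_set_scope.
Local Open Scope ring_scope.

HB.mixin Record Lmodule_isLieAlgebra (K : fieldType) L of GRing.Lmodule K L := {
  bracket : L -> L -> L;
  bracket_linearl : forall y : L, linear (fun x : L => bracket x y);
  bracket_linearr : forall x : L, linear (bracket x);
  bracket_alternating : forall x : L, bracket x x = 0;
  bracket_jacobi : forall x y z : L,
    bracket x (bracket y z) + bracket y (bracket z x) +
    bracket z (bracket x y) = 0
}.

#[short(type="lieAlgType")]
HB.structure Definition LieAlgebra (K : fieldType) :=
  { L of Lmodule_isLieAlgebra K L & GRing.Lmodule K L }.

Definition linear_span (K : fieldType) (V : lmodType K) (S : set V) : set V :=
  [set x | exists (n : nat) (c : 'I_n -> K) (v : 'I_n -> V),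
     (forall i, S (v i)) /\ x = \sum_(i < n) c i *: v i].

Definition lin_indep (K : fieldType) (V : lmodType K) (b : nat -> V) : Prop :=
  forall (n : nat) (c : nat -> K),
    \sum_(i < n) c i *: b i = 0 -> forall i, (i < n)%N -> c i = 0.

Definition is_basis (K : fieldType) (V : lmodType K) (b : nat -> V) : Prop :=
  lin_indep b /\ linear_span (range b) = setT.

Section LieAlgebraNotions.
Variables (K : fieldType) (L : lieAlgType K).

Definition bracket_span (A B : set L) : set L :=
  linear_span [set z | exists x y, [/\ A x, B y & z = bracket x y]].

Fixpoint derived_series (n : nat) : set L :=
  if n is m.+1 then bracket_span (derived_series m) (derived_series m)
  else setT.

Definition lie_solvable : Prop := exists n, derived_series n = [set 0].

Definition lie_abelian (A : set L) : Prop :=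
  forall x y, A x -> A y -> bracket x y = 0.

(* The basis is indexed by nat with a in position 0 and e j in position j for
   j >= 1; the value e 0 is never used.  For each j the series over s has only
   finitely many nonzero terms, so it is the partial sum up to any bound N
   beyond which lambda j vanishes. *)
Definition infinite_filiform : Prop :=
  exists (a : L) (e : nat -> L) (lambda : nat -> nat -> K),
    is_basis (fun i => if i is 0 then a else e i) /\
    forall j, (1 <= j)%N ->
      bracket a (e j) = e j.+1 /\
      exists N : nat,
        (forall s, (N <= s)%N -> lambda j s = 0) /\
        bracket (e j) (e j.+1) =
          \sum_(1 <= s < N) lambda j s *: e (2 * j + 1 + s)%N.

End LieAlgebraNotions.

Arguments lie_solvable {K} L.
Arguments infinite_filiform {K} L.

(* Main.v *)
(** Write [M] for the span of the [e_i] and identify it with [K[X]] by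
    [e_(i+1) <-> X^i], so that [ad a] is multiplication by [X] and an ideal of
    [L] inside [M] is an ideal of [K[X]].  If [L] is solvable, the last nonzero
    term of the derived series is therefore an abelian ideal [(q)] with
    [q <> 0].  As [[X^i, X^j]] is divisible by [X^(i+j+2)], the bracket is
    [X]-adically continuous, so the unit part of [q] can be inverted and the
    ideal [(X^n)] is abelian for some [n].

    If [(X^(n+1))] is abelian and [n >= 1], then so is [(X^n)]: on [(X^(n+1))]
    the operator [ad X^n] is multiplication by some polynomial [w], while
    [ad X^(n-1)] is [h - w d/dX] for some [h], since its commutator with [X] is
    [- w].  By Jacobi their commutator [- w w'] is [ad [X^(n-1), X^n]], which
    vanishes on [(X^(n+1))].  In characteristic zero [w] is thus constant, and
    it has no constant term.  Hence [(X)], which is [[L, L]], is abelian. *)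
Require Import Defs.
From HB Require Import structures.
From mathcomp Require Import all_boot all_algebra.
From mathcomp Require Import boolp classical_sets.
From mathcomp Require Import ring zify.

Set Implicit Arguments.
Unset Strict Implicit.
Unset Printing Implicit Defensive.

Import GRing.Theory.
Local Open Scope classical_set_scope.
Local Open Scope ring_scope.

(** * Linear maps on polynomials and divisibility by powers of ['X] *)

Lemma pchar0_deriv_eq0 (K : fieldType) (p : {poly K}) :
  [pchar K] =i pred0 -> p^`() = 0 -> p = (p`_0)%:P.
Proof.
move=> /pcharf0P charK dp; apply/polyP => -[|i]; rewrite coefC //=.
have /eqP := congr1 (fun q : {poly K} => q`_i) dp.
by rewrite coef_deriv coef0 -mulr_natr mulf_eq0 charK orbF => /eqP.
Qed.

Lemma eq0_dvdp_Xn (K : fieldType) (p : {poly K}) :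
  (forall N, 'X^N %| p) -> p = 0.
Proof.
move=> dvdX; apply/eqP/negPn/negP => p0.
by have := dvdp_leq p0 (dvdX (size p)); rewrite size_polyXn ltnn.
Qed.

Lemma dvdp_linear_Xn (K : fieldType) (f : {linear {poly K} -> {poly K}})
    (d : {poly K}) (j : nat) :
  (forall i, (j <= i)%N -> d %| f 'X^i) -> forall p, d %| f ('X^j * p).
Proof.
move=> df p; rewrite -[p]coefK poly_def mulr_sumr linear_sum /=.
apply: (big_ind (fun x => d %| x)) => [|x y|i _]; rewrite ?dvdp0 //.
  exact: dvdp_add.
rewrite -scalerAr linearZ /= -exprD -mul_polyC dvdp_mull // df //.
exact: leq_addr.
Qed.

(** This replaces inverting [u] as a power series. A Bezout relation between [u] and ['X^N] splits
    the argument into a multiple of ['X^n * u], killed by [f], and a multiple of ['X^N], whose image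
    is divisible by ['X^N]; and [N] is arbitrary. *)
Lemma linear_vanish_Xn (K : fieldType) (f : {linear {poly K} -> {poly K}})
    (n : nat) (u : {poly K}) :
  (forall N p, 'X^N %| f ('X^N * p)) -> ~~ root u 0 ->
  (forall p, f ('X^n * u * p) = 0) -> forall p, f ('X^n * p) = 0.
Proof.
move=> cf u0 fu p; apply: eq0_dvdp_Xn => N.
have : coprimep u 'X^N.
  by rewrite coprimep_expr // coprimepX.
case/Bezout_eq1_coprimepP=> -[v z] /= uv1.
have -> : 'X^n * p = 'X^n * u * (v * p) + 'X^N * ('X^n * z * p).
  by rewrite -[in LHS](mulr1 'X^n) -uv1; ring.
by rewrite linearD /= fu add0r cf.
Qed.

(** * Lie brackets on polynomials for which multiplication by ['X] is a derivation *)

Section PolynomialLieBracket.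
Variables (K : fieldType) (b : {poly K} -> {poly K} -> {poly K}).
Hypothesis charK : [pchar K] =i pred0.
Hypothesis b_linear : forall p, linear (b p).
Hypothesis bpp : forall p, b p p = 0.
Hypothesis b_anti : forall p r, b p r = - b r p.
Hypothesis b_jacobi : forall p r s,
  b p (b r s) + b r (b s p) + b s (b p r) = 0.
Hypothesis b_derX : forall p r, 'X * b p r = b ('X * p) r + b p ('X * r).
Hypothesis b_order : forall i j, 'X^(i + j + 2) %| b 'X^i 'X^j.

HB.instance Definition _ p := GRing.isLinear.Build K _ _ _ (b p) (b_linear p).

Lemma bracket_adic_continuous p N r : 'X^N %| b p ('X^N * r).
Proof.
apply: dvdp_linear_Xn => j leNj /=; rewrite b_anti dvdpNr -[p]mul1r -(expr0 'X).
apply: dvdp_linear_Xn => i _; apply: dvdp_trans (b_order _ _).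
by rewrite dvdp_Pexp2l ?size_polyX //; lia.
Qed.

(** Write [q] as ['X^n * u] with [u] nonzero at 0. The factor [u] is removed from one argument and
    then, by antisymmetry, from the other. *)
Lemma abelian_ideal_Xn q : q != 0 ->
  (forall p r, b (q * p) (q * r) = 0) ->
  exists n, forall p r, b ('X^n * p) ('X^n * r) = 0.
Proof.
move=> q0 bq; have [n [u]] := multiplicity_XsubC q 0.
rewrite q0 /= subr0 => u0; rewrite mulrC => qE; exists n => p.
apply: (@linear_vanish_Xn _ (b ('X^n * p)) n u) => //.
  by move=> N s; apply: bracket_adic_continuous.
move=> r; rewrite -qE /= b_anti; apply/eqP; rewrite oppr_eq0; apply/eqP.
apply: (@linear_vanish_Xn _ (b (q * r)) n u) => //.
  by move=> N s; apply: bracket_adic_continuous.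
by move=> s; rewrite -qE /= bq.
Qed.

(** * Lowering the exponent of an abelian ideal *)

Section Descent.
Variable n : nat.
Hypothesis abelian_n2 : forall p r : {poly K},
  b ('X^(n.+2) * p) ('X^(n.+2) * r) = 0.

Let abelian_Xn2 r : b 'X^(n.+2) ('X^(n.+2) * r) = 0.
Proof. by rewrite -[X in b X]mulr1 abelian_n2. Qed.

(** Since ['X^(n.+2)] acts as zero on the abelian ideal, [b_derX] makes [b 'X^(n.+1)] commute with
    ['X] there, so its value on the generator determines it. *)
Lemma bracket_Xn1E p : b 'X^(n.+1) ('X^(n.+2) * p) = p * b 'X^(n.+1) 'X^(n.+2).
Proof.
elim/poly_ind: p => [|p c IHp]; first by rewrite mulr0 mul0r linear0.
have := b_derX 'X^(n.+1) ('X^(n.+2) * p).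
rewrite -exprS abelian_Xn2 add0r IHp => eqX.
rewrite mulrDr linearD /= [p * 'X]mulrC mulrCA -eqX.
rewrite [_ * c%:P]mulrC mul_polyC linearZ /= -mul_polyC; ring.
Qed.

(** Moving [b 'X^n] past a factor ['X] costs a term in [b 'X^(n.+1)], known from [bracket_Xn1E];
    these terms add up to the derivative. *)
Lemma bracket_XnE p : b 'X^n ('X^(n.+2) * p) =
  p * b 'X^n 'X^(n.+2) - p^`() * b 'X^(n.+1) 'X^(n.+2).
Proof.
elim/poly_ind: p => [|p c IHp].
  by rewrite mulr0 deriv0 !mul0r subr0 linear0.
have := b_derX 'X^n ('X^(n.+2) * p).
rewrite -exprS bracket_Xn1E IHp => /esym/(canRL (addKr _)) eqX.
rewrite mulrDr linearD /= [p * 'X]mulrC mulrCA eqX.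
rewrite [_ * c%:P]mulrC mul_polyC linearZ /= -mul_polyC.
rewrite derivD derivC derivM derivX; ring.
Qed.

Lemma bracket_Xn1_eq0 : b 'X^(n.+1) 'X^(n.+2) = 0.
Proof.
have dvd_order i j k : (k <= i + j + 2)%N -> 'X^k %| b 'X^i 'X^j.
  by move=> le; apply: dvdp_trans (b_order i j); rewrite dvdp_Pexp2l ?size_polyX.
(* The orders are at least 2n+5, 2n+4 and 2n+3, so all three brackets lie in the abelian ideal. *)
have /dvdpP [w wE] : 'X^(n.+2) %| b 'X^(n.+1) 'X^(n.+2) by apply: dvd_order; lia.
have /dvdpP [y yE] : 'X^(n.+2) %| b 'X^n 'X^(n.+2) by apply: dvd_order; lia.
have /dvdpP [z zE] : 'X^(n.+2) %| b 'X^n 'X^(n.+1) by apply: dvd_order; lia.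
have := b_jacobi 'X^n 'X^(n.+1) 'X^(n.+2).
rewrite [b _ 'X^n]b_anti linearN /= zE yE.
rewrite [z * _]mulrC abelian_Xn2 addr0.
rewrite [y * _]mulrC bracket_Xn1E wE [w * _]mulrC bracket_XnE yE wE => eq0.
(* In the Jacobi sum the [z] term vanishes and the two products of [w] and [y] cancel. *)
have /eqP : w^`() * (w * 'X^(n.+2)) = 0.
  by rewrite -[LHS]opprK -[RHS]oppr0 -eq0; ring.
rewrite mulf_eq0 => /orP [/eqP dw|/eqP w0]; last by rewrite mulrC.
(* One more power of ['X] than in [wE]: the constant [w] has no constant term. *)
have /dvdpP [v vE] : 'X^(n.+3) %| b 'X^(n.+1) 'X^(n.+2) by apply: dvd_order; lia.
have wX : w = v * 'X.
  apply: (@mulIf _ 'X^(n.+2)); first by rewrite -size_poly_eq0 size_polyXn.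
  by rewrite -wE vE exprS mulrA.
rewrite (pchar0_deriv_eq0 charK dw) wX coefMX /=; ring.
Qed.

Lemma abelian_ideal_pred p r : b ('X^(n.+1) * p) ('X^(n.+1) * r) = 0.
Proof.
(* Here and below [poly_ind] only splits off the constant term; the remainder lies in the ideal of
   ['X^(n.+2)]. *)
have b0 s : b 'X^(n.+1) ('X^(n.+1) * s) = 0.
  elim/poly_ind: s => [|s c _]; first by rewrite mulr0 linear0.
  rewrite mulrDr linearD /= [s * 'X]mulrC mulrA -exprSr bracket_Xn1E.
  rewrite bracket_Xn1_eq0 mulr0 add0r [_ * c%:P]mulrC mul_polyC.
  by rewrite linearZ /= bpp scaler0.
elim/poly_ind: p => [|p c _]; first by rewrite mulr0 b_anti linear0 oppr0.
rewrite b_anti mulrDr linearD /= [_ * c%:P]mulrC mul_polyC linearZ /=.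
rewrite [b _ 'X^(n.+1)]b_anti b0 oppr0 scaler0 addr0 [p * 'X]mulrC mulrA -exprSr.
rewrite -b_anti; elim/poly_ind: r => [|r d _]; first by rewrite mulr0 linear0.
rewrite mulrDr linearD /= [r * 'X]mulrC mulrA -exprSr abelian_n2 add0r.
rewrite [_ * d%:P]mulrC mul_polyC linearZ /= b_anti bracket_Xn1E.
by rewrite bracket_Xn1_eq0 mulr0 oppr0 scaler0.
Qed.

End Descent.

Lemma abelian_ideal_X q : q != 0 ->
  (forall p r, b (q * p) (q * r) = 0) ->
  forall p r, b ('X * p) ('X * r) = 0.
Proof.
move=> q0 /(abelian_ideal_Xn q0) [n].
elim: n => [bn p r|[|n] IHn bn].
  by have := bn ('X * p) ('X * r); rewrite !mul1r.
  exact: bn.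
exact/IHn/abelian_ideal_pred.
Qed.

End PolynomialLieBracket.

(** * Linear spans *)

Section LinearSpan.
Variables (K : fieldType) (V : lmodType K).

Lemma linear_span_ind (S : set V) (P : V -> Prop) :
  P 0 -> (forall x y, P x -> P y -> P (x + y)) ->
  (forall c x, P x -> P (c *: x)) -> (forall x, S x -> P x) ->
  forall x, linear_span S x -> P x.
Proof.
move=> P0 PD PZ PS x [n [c [v [Sv ->]]]].
by apply: (big_ind P) => // i _; apply/PZ/PS.
Qed.

Lemma linear_span0 (S : set V) : linear_span S 0.
Proof.
exists 0%N, (fun=> 0), (fun=> 0); split; first by case.
by rewrite big_ord0.
Qed.

Lemma linear_spanZ (S : set V) c x : linear_span S x -> linear_span S (c *: x).
Proof.
case=> n [d [v [Sv ->]]]; exists n, (fun i => c * d i), v; split => //.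
by rewrite scaler_sumr; apply: eq_bigr => i _; rewrite scalerA.
Qed.

Lemma linear_spanD (S : set V) x y :
  linear_span S x -> linear_span S y -> linear_span S (x + y).
Proof.
case=> n [c [v [Sv ->]]] [m [d [w [Sw ->]]]].
exists (n + m)%N, (fun i => match split i with inl j => c j | inr j => d j end),
  (fun i => match split i with inl j => v j | inr j => w j end); split.
  by move=> i; case: (split i).
rewrite big_split_ord /=; congr (_ + _); apply: eq_bigr => i _.
  by rewrite (unsplitK (inl i : 'I_n + 'I_m)).
by rewrite (unsplitK (inr i : 'I_n + 'I_m)).
Qed.

Lemma linear_span_gen (S : set V) x : S x -> linear_span S x.
Proof.
move=> Sx; exists 1%N, (fun=> 1), (fun=> x); split => //.
by rewrite big_ord1 scale1r.
Qed.

End LinearSpan.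

(** * The derived series of a Lie algebra *)

Section LieAlgebraTheory.
Variables (K : fieldType) (L : lieAlgType K).
Implicit Types x y z : L.

HB.instance Definition _ x :=
  GRing.isLinear.Build K L L _ (bracket x) (bracket_linearr x).

Lemma bracketC x y : bracket x y = - bracket y x.
Proof.
have bDl u v w : bracket (u + v) w = bracket u w + bracket v w.
  by have := bracket_linearl w 1 u v; rewrite /= !scale1r.
apply/eqP; rewrite -addr_eq0; have := bracket_alternating (x + y).
by rewrite bDl !linearD /= !bracket_alternating add0r addr0 => ->.
Qed.

Lemma bracket_derivation x y z :
  bracket x (bracket y z) = bracket (bracket x y) z + bracket y (bracket x z).
Proof.
have /eqP := bracket_jacobi x y z.
rewrite -addrA addr_eq0 => /eqP ->; rewrite [bracket z (bracket _ _)]bracketC.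
by rewrite [bracket z x]bracketC linearN /= opprD !opprK addrC.
Qed.

Lemma derived_series_bracket n x y :
  derived_series n y -> derived_series n (bracket x y).
Proof.
elim: n y => [//|n IHn].
apply: linear_span_ind => [|u v|c u|u].
- by rewrite linear0; apply: linear_span0.
- by rewrite linearD; apply: linear_spanD.
- by rewrite linearZ; apply: linear_spanZ.
move=> [v [w [Dv Dw ->]]]; rewrite bracket_derivation.
apply: linear_spanD; apply: linear_span_gen.
- by exists (bracket x v), w; split => //; apply: IHn.
- by exists v, (bracket x w); split => //; apply: IHn.
Qed.

(** The nonvanishing of the first derived term forces a positive index, which places the abelian
    term inside [[L, L]]. *)
Lemma last_derived_term : @derived_series K L 1 <> [set 0] -> lie_solvable L ->
  exists n, derived_series n.+1 <> [set 0 : L] /\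
            lie_abelian (derived_series n.+1 : set L).
Proof.
move=> D1 [n]; elim: n => [D0|n IHn Dn].
  case: D1; apply/seteqP; split => x /=; last by move=> ->; apply: linear_span0.
  have D00 (y : L) : y = 0 by have : [set: L] y by []; rewrite [setT]D0.
  by rewrite (D00 x).
have [/IHn//|Dn0] := pselect (derived_series n = [set 0 : L]).
case: n Dn Dn0 {IHn} => [|n] Dn Dn0; first by [].
exists n; split => // x y Dx Dy.
have : derived_series n.+2 (bracket x y).
  by apply: linear_span_gen; exists x, y.
by rewrite Dn.
Qed.

End LieAlgebraTheory.

(** * Polynomial coordinates on a filiform algebra *)

Section FiliformCoordinates.
Variables (K : fieldType) (L : lieAlgType K).
Variables (a : L) (e : nat -> L) (lambda : nat -> nat -> K).
Hypothesis basis_ae : is_basis (fun i => if i is 0 then a else e i).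
Hypothesis bracket_ae : forall j, (1 <= j)%N -> bracket a (e j) = e j.+1.
Hypothesis bracket_ee : forall j, (1 <= j)%N -> exists N : nat,
  bracket (e j) (e j.+1) =
    \sum_(1 <= s < N) lambda j s *: e (2 * j + 1 + s)%N.

Definition poly_embed (p : {poly K}) : L := \sum_(i < size p) p`_i *: e i.+1.
Local Notation phi := poly_embed.

Lemma poly_embed_widen n (p : {poly K}) : (size p <= n)%N ->
  phi p = \sum_(i < n) p`_i *: e i.+1.
Proof.
move=> le_pn; rewrite /phi (big_ord_widen _ (fun i => p`_i *: e i.+1) le_pn).
rewrite big_mkcond; apply: eq_bigr => i _; case: ltnP => // lepi.
by rewrite nth_default // scale0r.
Qed.

Fact poly_embed_is_linear : linear phi.
Proof.
move=> c p r; pose n := maxn (size p) (size r).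
rewrite (@poly_embed_widen n); last first.
  rewrite (leq_trans (size_polyD _ _)) // geq_max leq_maxr andbT.
  exact: leq_trans (size_scale_leq _ _) (leq_maxl _ _).
rewrite (@poly_embed_widen n p) ?leq_maxl // (@poly_embed_widen n r) ?leq_maxr //.
rewrite scaler_sumr -big_split /=; apply: eq_bigr => i _.
by rewrite coefD coefZ scalerDl scalerA.
Qed.
HB.instance Definition _ :=
  GRing.isLinear.Build K {poly K} L _ phi poly_embed_is_linear.

Lemma poly_embedXn i : phi 'X^i = e i.+1.
Proof.
rewrite /phi size_polyXn big_ord_recr /= coefXn eqxx scale1r big1 ?add0r // => j _.
by rewrite coefXn (ltn_eqF (ltn_ord j)) scale0r.
Qed.

Lemma poly_embed_eq0 p : phi p = 0 -> p = 0.
Proof.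
move=> p0; apply/polyP => i; rewrite coef0.
have [lt_ip|] := ltnP i (size p); last exact: nth_default.
(* Position 0 of the basis is [a], hence the zero coefficient and the shift. *)
pose c j := if j is k.+1 then p`_k else 0.
apply: (basis_ae.1 (size p).+1 c _ i.+1) => //.
by rewrite big_ord_recl /= scale0r add0r.
Qed.

Lemma poly_embed_inj : injective phi.
Proof.
move=> p r pr; apply/eqP; rewrite -subr_eq0; apply/eqP/poly_embed_eq0.
by rewrite linearB /= pr subrr.
Qed.

Lemma poly_sumXn (p : {poly K}) : p = \sum_(i < size p) p`_i *: 'X^i.
Proof. by rewrite -poly_def coefK. Qed.

Lemma bracket_a_embed p : bracket a (phi p) = phi ('X * p).
Proof.
rewrite [p in RHS]poly_sumXn mulr_sumr !linear_sum /=; apply: eq_bigr => i _.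
by rewrite -scalerAr -exprS !linearZ /= poly_embedXn bracket_ae.
Qed.

Lemma filiform_decomp x : exists c p, x = c *: a + phi p.
Proof.
have : [set: L] x by [].
rewrite -basis_ae.2; move: x; apply: linear_span_ind => [|x y|d x|x].
- by exists 0, 0; rewrite linear0 scale0r addr0.
- move=> [c [p ->]] [d [r ->]]; exists (c + d), (p + r).
  by rewrite linearD scalerDl addrACA.
- by move=> [c [p ->]]; exists (d * c), (d *: p); rewrite linearZ scalerDr scalerA.
move=> [[|i] _ <-]; first by exists 1, 0; rewrite linear0 scale1r addr0.
by exists 0, 'X^i; rewrite scale0r add0r poly_embedXn.
Qed.

(** Induction on the gap between [i] and [j]. Gap 1 is the defining relation; as [ad a] is a
    derivation, [X^i, X^(i+k+2)] = X [X^i, X^(i+k+1)] - [X^(i+1), X^(i+k+1)], with smaller gaps on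
    the right. *)
Lemma bracket_embedXn i j :
  exists s, bracket (phi 'X^i) (phi 'X^j) = phi ('X^(i + j + 2) * s).
Proof.
wlog le_ij : i j / (i <= j)%N => [wlg|].
  have [/wlg//|/ltnW/wlg [s sE]] := leqP i j.
  by exists (- s); rewrite bracketC sE mulrN linearN [(i + j)%N]addnC.
rewrite -(subnKC le_ij); set k := (j - i)%N; move: k => k {le_ij j}.
have [m] := ubnP k; elim: m i k => // m IHm i [|[|k]] lt_km.
- by exists 0; rewrite addn0 bracket_alternating mulr0 linear0.
- rewrite addn1 !poly_embedXn; have [N ->] := bracket_ee (ltn0Sn i).
  (* The vector e_(2(i+1)+1+s) is the image of X^(2i+2+s), and 2i+3 of these powers are factored
     out. *)
  exists (\sum_(1 <= s < N) lambda i.+1 s *: 'X^(s.-1)).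
  rewrite mulr_sumr linear_sum /= !big_nat; apply: eq_bigr => s /andP [s1 _].
  rewrite -scalerAr linearZ /= -exprD poly_embedXn; congr (_ *: e _); lia.
have [|s sE] := IHm i k.+1; first lia.
have [|t tE] := IHm i.+1 k; first lia.
exists (s - t).
have := bracket_derivation a (phi 'X^i) (phi 'X^(i + k.+1)).
rewrite sE !bracket_a_embed -!exprS -addnS => /esym/(canRL (addKr _)) ->.
rewrite -addSnnS tE mulrA -exprS addrC mulrBr linearB /=.
by congr (phi ('X^_ * _) - phi ('X^_ * _)); lia.
Qed.

Lemma bracket_embed p r : exists s, bracket (phi p) (phi r) = phi s.
Proof.
suff mono i t : exists s, bracket (phi 'X^i) (phi t) = phi s.
  rewrite bracketC (poly_sumXn p) [phi (\sum_(i < _) _)]linear_sum linear_sum /=.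
  rewrite -sumrN; apply: (big_ind (fun x => exists s, x = phi s)).
  - by exists 0; rewrite linear0.
  - by move=> x y [s ->] [t ->]; exists (s + t); rewrite linearD.
  move=> i _; have [s sE] := mono i r; exists (p`_i *: s).
  by rewrite !linearZ /= -bracketC sE.
rewrite (poly_sumXn t) [phi (\sum_(i < _) _)]linear_sum linear_sum /=.
apply: (big_ind (fun x => exists s, x = phi s)).
- by exists 0; rewrite linear0.
- by move=> x y [s ->] [u ->]; exists (s + u); rewrite linearD.
move=> j _; have [s sE] := bracket_embedXn i j.
by exists (t`_j *: ('X^(i + j + 2) * s)); rewrite !linearZ /= sE.
Qed.

Definition poly_bracket p r : {poly K} := projT1 (cid (bracket_embed p r)).
Local Notation b := poly_bracket.

Lemma poly_bracketE p r : phi (b p r) = bracket (phi p) (phi r).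
Proof. by rewrite /b; case: cid. Qed.

Lemma poly_bracket_linear p : linear (b p).
Proof.
move=> c r s; apply: poly_embed_inj.
by rewrite poly_bracketE !linearP /= !poly_bracketE.
Qed.

Lemma poly_bracket_alternating p : b p p = 0.
Proof.
by apply: poly_embed_inj; rewrite poly_bracketE bracket_alternating linear0.
Qed.

Lemma poly_bracketC p r : b p r = - b r p.
Proof.
by apply: poly_embed_inj; rewrite linearN /= !poly_bracketE bracketC.
Qed.

Lemma poly_bracket_jacobi p r s : b p (b r s) + b r (b s p) + b s (b p r) = 0.
Proof.
by apply: poly_embed_inj; rewrite !linearD /= !poly_bracketE bracket_jacobi linear0.
Qed.

Lemma poly_bracket_derX p r : 'X * b p r = b ('X * p) r + b p ('X * r).
Proof.
apply: poly_embed_inj; rewrite linearD /= -bracket_a_embed !poly_bracketE.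
by rewrite -!bracket_a_embed bracket_derivation.
Qed.

Lemma poly_bracket_order i j : 'X^(i + j + 2) %| b 'X^i 'X^j.
Proof.
have [s sE] := bracket_embedXn i j; apply/dvdpP; exists s.
by apply: poly_embed_inj; rewrite poly_bracketE sE mulrC.
Qed.

Lemma poly_bracket_dvdX p r : 'X %| b p r.
Proof.
have dvdX i j : 'X %| b 'X^i 'X^j.
  by apply: dvdp_trans (poly_bracket_order i j); rewrite addn2 exprS dvdp_mulr.
pose f q : {linear {poly K} -> {poly K}} :=
  HB.pack (b q) (GRing.isLinear.Build K _ _ _ (b q) (poly_bracket_linear q)).
rewrite -[r]mul1r -(expr0 'X); apply: (@dvdp_linear_Xn _ (f p)) => j _ /=.
rewrite poly_bracketC dvdpNr -[p]mul1r -(expr0 'X).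
by apply: (@dvdp_linear_Xn _ (f 'X^j)) => i _; apply: dvdX.
Qed.

(** Brackets with [a] gain a factor ['X] from [bracket_a_embed]; the others have one by
    [poly_bracket_dvdX]. *)
Lemma bracket_in_X x y : exists p, bracket x y = phi ('X * p).
Proof.
have [c [p ->]] := filiform_decomp x; have [d [r ->]] := filiform_decomp y.
have /dvdpP [s sE] := poly_bracket_dvdX p r.
have xa : bracket (c *: a + phi p) a = - phi ('X * p).
  by rewrite bracketC linearD linearZ /= bracket_alternating scaler0 add0r
    bracket_a_embed.
have xr : bracket (c *: a + phi p) (phi r) = c *: phi ('X * r) + phi (b p r).
  rewrite bracketC linearD linearZ /= opprD -scalerN -!bracketC.
  by rewrite bracket_a_embed poly_bracketE.
exists (c *: r - d *: p + s).
rewrite linearD linearZ /= xa xr sE addrCA addrA scalerN -!linearZ -linearB -linearD.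
by congr phi; rewrite -!mul_polyC; ring.
Qed.

Lemma bracket_span_in_X A B x : bracket_span A B x ->
  exists p, x = phi ('X * p).
Proof.
move: x; apply: linear_span_ind => [|x y|c x|x].
- by exists 0; rewrite mulr0 linear0.
- by move=> [p ->] [r ->]; exists (p + r); rewrite mulrDr linearD.
- by move=> [p ->]; exists (c *: p); rewrite -scalerAr linearZ.
by move=> [u [v [_ _ ->]]]; apply: bracket_in_X.
Qed.

(** Each derived term is an ideal, and bracketing with [a] multiplies by ['X]. *)
Lemma derived_series_embed_mul n q p :
  derived_series n.+1 (phi q) -> derived_series n.+1 (phi (q * p)).
Proof.
move=> Dq; elim/poly_ind: p => [|p c IHp].
  by rewrite mulr0 linear0; apply: linear_span0.
rewrite mulrDr linearD; apply: linear_spanD.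
  rewrite /= mulrA [_ * 'X]mulrC -bracket_a_embed.
  exact: (@derived_series_bracket _ _ n.+1).
by rewrite mulrC mul_polyC linearZ; apply: linear_spanZ.
Qed.

Lemma derived1_neq0 : @derived_series K L 1 <> [set 0].
Proof.
move=> D1; have : derived_series 1 (phi 'X).
  apply: linear_span_gen; exists a, (phi 1); split => //.
  by rewrite bracket_a_embed mulr1.
by rewrite D1 => /poly_embed_eq0/eqP; rewrite polyX_eq0.
Qed.

Lemma solvable_filiform_abelian : [pchar K] =i pred0 -> lie_solvable L ->
  lie_abelian (bracket_span [set: L] [set: L]).
Proof.
move=> charK /(last_derived_term derived1_neq0) [n [Dn0 Dab]].
(* The term has positive index, so all its elements are images of polynomials. *)
have [q q0 Dq] : exists2 q, q != 0 & derived_series n.+1 (phi q).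
  apply: contrapT => noq; apply: Dn0; apply/seteqP; split => x /=; last first.
    by move=> ->; apply: linear_span0.
  move=> Dx; have [p xE] := bracket_span_in_X Dx; rewrite xE.
  have [->|p0] := eqVneq ('X * p) 0; first by rewrite linear0.
  by case: noq; exists ('X * p) => //; rewrite -xE.
have babel := abelian_ideal_X charK poly_bracket_linear poly_bracket_alternating
  poly_bracketC poly_bracket_jacobi poly_bracket_derX poly_bracket_order q0.
move=> x y /bracket_span_in_X [p ->] /bracket_span_in_X [r ->].
rewrite -poly_bracketE babel ?linear0 // => s t.
apply: poly_embed_inj; rewrite poly_bracketE linear0.
by apply: Dab; apply: derived_series_embed_mul.
Qed.

End FiliformCoordinates.

Theorem theorem2p2 (K : fieldType) (charK : [pchar K] =i pred0)
    (L : lieAlgType K) (filL : infinite_filiform L) (solL : lie_solvable L) :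
  lie_abelian (bracket_span [set: L] [set: L]).
Proof.
have [a [e [lambda [basis_ae brackets]]]] := filL.
apply: (@solvable_filiform_abelian K L a e lambda) => // j j1.
- by have [] := brackets j j1.
- by have [_ [N [_ eN]]] := brackets j j1; exists N.
Qed.
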